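(* Let $\Gamma$ be a finite group, let $X \subseteq \Gamma$ be a connection set, and let $G = \operatorname{Cay}(\Gamma, X)$. Then \[ \vartheta(G) = \max \Big\{ A_1 \;:\; A_\pi \in \mathcal{S}^{d_\pi}_{\succeq 0} \text{ for each } \pi \in \hat\Gamma,\ \sum_{\pi \in \hat\Gamma} d_\pi \operatorname{Tr}(A_\pi) = |\Gamma|,\ \sum_{\pi \in \hat\Gamma} d_\pi \langle A_\pi, \pi(x) \rangle = 0 \text{ for all } x \in X \Big\}, \] where $1 \in \hat\Gamma$ denotes the trivial representation (so $A_1$ is a $1 \times 1$ matrix, identified with a scalar).
   Context: A subset $X$ of a finite group $\Gamma$ with unit element $e$ is a connection set if $e \notin X$ and $x^{-1} \in X$ whenever $x \in X$. (It is not required that $X$ generates $\Gamma$.) The Cayley graph $\operatorname{Cay}(\Gamma, X)$ is the simple undirected graph with vertex set $\Gamma$ in which vertices $x$ and $y$ are adjacent if and only if $y^{-1}x \in X$. For a finite simple undirected graph $G = (V,E)$, the Lovász $\vartheta$-number is \[ \vartheta(G) = \max \Big\{ \sum_{u,v \in V} A(u,v) \;:\; A \in \mathcal{S}^V_{\succeq 0} \text{ real-valued},\ \operatorname{Tr}(A) = 1,\ A(u,v) = 0 \text{ for } \{u,v\} \in E \Big\}, \] where $\mathcal{S}^V_{\succeq 0}$ is the set of (complex, Hermitian) positive semidefinite matrices with rows and columns indexed by $V$; so the real-valued ones are the real symmetric positive semidefinite matrices. For $V = \{1,\dots,n\}$ this set is written $\mathcal{S}^n_{\succeq 0}$ (complex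 Hermitian positive semidefinite $n \times n$ matrices). $\hat\Gamma$ is a fixed set of mutually inequivalent irreducible unitary representations $\pi \colon \Gamma \to \mathrm{U}(d_\pi)$ of $\Gamma$ containing exactly one representative of each unitary equivalence class; here $\mathrm{U}(d_\pi)$ is the group of unitary $d_\pi \times d_\pi$ complex matrices and $d_\pi$ is the degree of $\pi$. For square complex matrices $A, B$ of the same size, $\langle A, B \rangle = \operatorname{Tr}(B^* A)$, where $B^*$ is the conjugate transpose of $B$. *)

(* Defs.v *)
(* The complex numbers are [R[i]], with [R : realType]. *)
From mathcomp Require Import all_boot all_order all_algebra all_fingroup.
From mathcomp Require Import sesquilinear spectral mxrepresentation.
From mathcomp Require Import classical_sets reals.
From mathcomp.real_closed Require Import complex.

Set Implicit Arguments.
Unset Strict Implicit.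
Unset Printing Implicit Defensive.

Import Order.TTheory GRing.Theory Num.Theory.
Local Open Scope ring_scope.
Local Open Scope complex_scope.
Local Open Scope sesquilinear_scope.

Definition is_maximum (R : realType) (S : set R) (m : R) : Prop :=
  S m /\ (forall s : R, S s -> s <= m).

Definition psdmx (R : realType) (n : nat) (A : 'M[R[i]]_n) : Prop :=
  A \is hermsymmx /\ forall x : 'cV[R[i]]_n, 0 <= (x ^t* *m A *m x) 0 0.

Definition mxinner (R : realType) (n : nat) (A B : 'M[R[i]]_n) : R[i] :=
  \tr (B ^t* *m A).

(* Rows and columns indexed by a finite type [V] are numbered by [enum_rank]. *)
Definition entry (R : realType) (V : finType) (A : 'M[R[i]]_#|V|) (u v : V) :
    R[i] :=
  A (enum_rank u) (enum_rank v).

Definition theta_feasible (R : realType) (V : finType) (E : rel V)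
    (A : 'M[R[i]]_#|V|) : Prop :=
  [/\ psdmx A, A \is a realmx, \tr A = 1 &
      forall u v : V, E u v -> entry A u v = 0].

Definition theta_values (R : realType) (V : finType) (E : rel V) : set R :=
  fun t => exists2 A : 'M[R[i]]_#|V|, theta_feasible E A &
    t%:C = \sum_(u : V) \sum_(v : V) entry A u v.
Arguments theta_values R {V} E _.

(* [sup] is total; that it is attained is a separate assertion,
   [is_maximum (theta_values R E) (lovasz_theta R E)]. *)
Definition lovasz_theta (R : realType) (V : finType) (E : rel V) : R :=
  sup (theta_values R E).
Arguments lovasz_theta R {V} E.

Definition connection_set (gT : finGroupType) (X : {set gT}) : Prop :=
  1%g \notin X /\ forall x : gT, x \in X -> x^-1%g \in X.

Definition Cay (gT : finGroupType) (X : {set gT}) : rel gT :=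
  fun x y => (y^-1 * x)%g \in X.

Lemma Cay_irreflexive (gT : finGroupType) (X : {set gT}) :
  connection_set X -> irreflexive (Cay X).
Proof. by case=> X1 _ x; rewrite /Cay mulVg (negbTE X1). Qed.

Lemma Cay_symmetric (gT : finGroupType) (X : {set gT}) :
  connection_set X -> symmetric (Cay X).
Proof.
case=> _ XV x y; rewrite /Cay.
by apply/idP/idP=> /XV; rewrite invMg invgK.
Qed.

Definition unitary_repr (R : realType) (gT : finGroupType) (n : nat)
    (rho : mx_representation R[i] [set: gT] n) : Prop :=
  forall x : gT, rho x \is unitarymx.

Definition unitary_equiv (R : realType) (gT : finGroupType) (m n : nat)
    (rho : mx_representation R[i] [set: gT] m)
    (sigma : mx_representation R[i] [set: gT] n) : Prop :=
  m = n /\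
  exists2 U : 'M[R[i]]_(m, n), U \is unitarymx &
    forall x : gT, rho x *m U = U *m sigma x.

(* A complete set of mutually inequivalent irreducible unitary representations;
   every such set is finite, so the index type is a [finType]. *)
Record unitary_dual (R : realType) (gT : finGroupType) := UnitaryDual {
  dual_index :> finType;
  deg : dual_index -> nat;
  irrep : forall p : dual_index, mx_representation R[i] [set: gT] (deg p);
  irrep_irreducible : forall p, mx_irreducible (irrep p);
  irrep_unitary : forall p, unitary_repr (irrep p);
  irrep_inequiv : forall p q, unitary_equiv (irrep p) (irrep q) -> p = q;
  irrep_complete : forall (n : nat) (rho : mx_representation R[i] [set: gT] n),
    mx_irreducible rho -> unitary_repr rho ->
    exists p, unitary_equiv rho (irrep p)
}.

Lemma unitary_dual_trivial (R : realType) (gT : finGroupType)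
    (D : unitary_dual R gT) :
  exists2 one : D, deg one = 1%N & forall x : gT, irrep one x = 1%:M.
Proof.
have H : mx_repr [set: gT] (fun=> 1%:M : 'M[R[i]]_1).
  by split=> // x y _ _; rewrite mulmx1.
have irr : mx_irreducible (MxRepresentation H).
  by apply: mx_abs_irrW; exact: linear_mx_abs_irr.
have un : unitary_repr (MxRepresentation H).
  by move=> x; apply/unitarymxP; rewrite /= trmx1 map_mx1 mulmx1.
have [p [e [U Uu UE]]] := irrep_complete D irr un.
exists p => // x; have /= := UE x; rewrite mul1mx => {UE}.
move: (irrep p x) => M; move: e U Uu M.
case: _ / => U /unitarymxP /mulmx1C UU M E.
by rewrite -[M]mul1mx -UU -mulmxA -E.
Qed.

Definition dual_feasible (R : realType) (gT : finGroupType)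
    (D : unitary_dual R gT) (X : {set gT})
    (A : forall p : D, 'M[R[i]]_(deg p)) : Prop :=
  [/\ forall p : D, psdmx (A p),
      \sum_(p : D) (deg p)%:R * \tr (A p) = #|gT|%:R &
      forall x : gT, x \in X ->
        \sum_(p : D) (deg p)%:R * mxinner (A p) (irrep p x) = 0].

(* [one] is the index of the trivial representation; [deg1] is used only to
   read the 1 x 1 matrix [A one] as a scalar. *)
Definition dual_values (R : realType) (gT : finGroupType)
    (D : unitary_dual R gT) (one : D) (deg1 : deg one = 1%N) (X : {set gT}) :
    set R :=
  fun t => exists2 A : forall p : D, 'M[R[i]]_(deg p), dual_feasible X A &
    t%:C = castmx (deg1, deg1) (A one) 0 0.

(* Main.v *)
Require Import Defs.
From mathcomp Require Import all_boot all_order all_algebra all_fingroup.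
From mathcomp Require Import mxrepresentation classical_sets reals.
From mathcomp.real_closed Require Import complex.
From mathcomp Require Import sesquilinear spectral pgroup.
From mathcomp Require Import boolp topology normedtype derive.

Set Implicit Arguments.
Unset Strict Implicit.
Unset Printing Implicit Defensive.

Import Order.TTheory GRing.Theory Num.Theory.
Import numFieldNormedType.Exports.

Local Open Scope ring_scope.
Local Open Scope sesquilinear_scope.

(** The bridge between the two sides is a third optimisation problem, over the
    functions [f : gT -> R[i]] that are real-valued, positive definite (the
    kernel [f (y^-1 * x)] is positive semidefinite), normalised by [f 1 = 1]
    and zero on the connection set.  Both value sets in the theorem are equal to
    the set of sums [\sum_g f g] over such [f].

    For theta, [Cay X] and the objective are invariant under left translations,
    so a feasible matrix may be replaced by its average over translations, which
    is a kernel of the form [f (y^-1 * x)]; this is [theta_valuesP].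

    For the representation side, Fourier analysis on the finite group identifies
    positive definite functions with families of positive semidefinite
    matrices: [fourier f p = \sum_x f x *: irrep p x], with inverse
    [inverse_fourier A x = #|gT|^-1 \sum_p d_p <A_p, p(x)>].  Under this
    correspondence the trace condition reads [f 1 = 1], the linear conditions
    read [f = 0] on [X], and the entry at the trivial representation is
    [\sum_g f g], because the elements of the group sum to [0] in every other
    irreducible representation ([sum_irrep_nontrivial]).  The inversion formula
    rests on the decomposition of the regular character
    ([dual_trace_sum]): [\sum_p d_p tr p(g)] is [#|gT|] at [1] and [0]
    elsewhere.  To carry it from abstract irreducible representations to a
    unitary dual one needs that every representation is similar to a
    unitary one ([unitarizable]) and that similar irreducible unitary
    representations are unitarily equivalent ([rsim_unitary_equiv]).
    A family of complex matrices yields a complex-valued [f]; its real part is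
    again feasible and has the same sum, since that sum is real
    ([dual_valuesP]).

    The maximum is attained because the feasible matrices of theta form a
    compact set ([theta_values_maximum]): they are cut out by closed linear
    conditions, and the entries of a real positive semidefinite matrix of trace
    [1] are bounded by [1]. *)

(** * Positive semidefinite matrices and kernels *)

Section PositiveKernels.

Variable R : realType.
Local Notation C := R[i].

Lemma adjmxM m n p (A : 'M[C]_(m, n)) (B : 'M[C]_(n, p)) :
  (A *m B)^t* = B^t* *m A^t*.
Proof. by rewrite trmx_mul map_mxM. Qed.

Lemma mulmx_adj_diag m n (A : 'M[C]_(m, n)) i :
  (A *m A^t*) i i = \sum_j `|A i j| ^+ 2.
Proof. by rewrite mxE; apply: eq_bigr => j _; rewrite !mxE -normCK. Qed.

(** Over the complex numbers a quadratic form with real values comes from a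
    Hermitian matrix.  With [b] the sesquilinear form of [A], the values of the
    quadratic form at [x + y] and at [x + 'i *: y] are real, so [b x y + b y x]
    and ['i * (b x y - b y x)] are real, which forces [b x y = (b y x)^*]. *)
Lemma psdmx_quad n (A : 'M[C]_n) :
  (forall x : 'cV_n, 0 <= (x^t* *m A *m x) 0 0) -> psdmx A.
Proof.
move=> Apos; split=> //; apply/is_hermitianmxP; rewrite scale1r.
pose b (x y : 'cV[C]_n) : C := (x^t* *m A *m y) 0 0.
have bDl x y z : b (x + y) z = b x z + b y z.
  rewrite /b; have -> : (x + y)^t* = x^t* + y^t* :> 'rV[C]_n.
    by apply/rowP => i; rewrite !mxE rmorphD.
  by rewrite !mulmxDl mxE.
have bDr x y z : b x (y + z) = b x y + b x z by rewrite /b mulmxDr mxE.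
have bZl a x y : b (a *: x) y = a^* * b x y.
  rewrite /b; have -> : (a *: x)^t* = a^* *: x^t* :> 'rV[C]_n.
    by apply/rowP => i; rewrite !mxE rmorphM.
  by rewrite -!scalemxAl mxE.
have bZr a x y : b x (a *: y) = a * b x y by rewrite /b -scalemxAr mxE.
have b_real x : (b x x)^* = b x x by apply/CrealP/ger0_real/Apos.
have bE i j : b (delta_mx i 0) (delta_mx j 0) = A i j.
  rewrite /b; have -> : (delta_mx i 0)^t* = delta_mx 0 i :> 'rV[C]_n.
    by rewrite trmx_delta map_delta_mx.
  by rewrite -rowE -colE !mxE.
clearbody b.
have b_sum x y : (b x y)^* + (b y x)^* = b x y + b y x.
  have := b_real (x + y); rewrite bDl !bDr !rmorphD /= !b_real.
  by rewrite -!addrA => /addrI; rewrite !addrA => /addIr.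
have b_herm x y : b x y = (b y x)^*.
  have := b_sum x ('i *: y); rewrite bZl bZr !rmorphM /= conjCK conjCi.
  rewrite !mulNr addrC -[RHS]opprK opprD opprK [in RHS]addrC -!mulrBr -mulrN.
  move/(mulfI (neq0Ci _)) => b_diff.
  have : (b y x)^* *+ 2 = b x y *+ 2.
    rewrite mulr2n -[LHS]add0r -(subrr (b x y)^*) addrACA [- _ + _]addrC.
    by rewrite b_sum b_diff opprB addrACA subrr addr0.
  by move/eqP; rewrite eqrMn2r // => /eqP.
by apply/matrixP => i j; rewrite !mxE -!bE b_herm.
Qed.

Lemma quadE n (A : 'M[C]_n) (x : 'cV_n) :
  (x^t* *m A *m x) 0 0 = \sum_i \sum_j (x i 0)^* * A i j * x j 0.
Proof.
rewrite mxE exchange_big; apply: eq_bigr => j _; rewrite mxE mulr_suml.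
by apply: eq_bigr => i _; rewrite !mxE.
Qed.

(** Kernels avoid the numbering of [V]: translations by group elements act on
    the two arguments directly, which they do not on matrix indices. *)
Definition psd_kernel (V : finType) (K : V -> V -> C) : Prop :=
  forall c : V -> C, 0 <= \sum_u \sum_v (c u)^* * K u v * c v.

Lemma psdmx_entry (V : finType) (A : 'M[C]_#|V|) :
  psdmx A <-> psd_kernel (entry A).
Proof.
have rank_bij := onW_bij (fun=> true) (enum_rank_bij V).
split=> [[_ Apos] c|Apos].
  have := Apos (\col_i c (enum_val i)); rewrite quadE (reindex _ rank_bij).
  congr (0 <= _); apply: eq_bigr => u _; rewrite (reindex _ rank_bij).
  by apply: eq_bigr => v _; rewrite !mxE !enum_rankK.
apply: psdmx_quad => x; rewrite quadE (reindex _ rank_bij).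
have := Apos (fun u => x (enum_rank u) 0); congr (0 <= _).
by apply: eq_bigr => u _; rewrite (reindex _ rank_bij).
Qed.

(** The conjugate of a positive semidefinite kernel is positive semidefinite:
    its form at [c] is the conjugate of the form of [K] at [c^*].  The real part
    is the mean of [K] and its conjugate. *)
Lemma psd_kernel_Re (V : finType) (K : V -> V -> C) :
  psd_kernel K -> psd_kernel (fun u v => 'Re (K u v)).
Proof.
move=> Kpos c.
have -> : \sum_u \sum_v (c u)^* * 'Re (K u v) * c v =
    (\sum_u \sum_v (c u)^* * K u v * c v +
     (\sum_u \sum_v ((c u)^*)^* * K u v * (c v)^*)^*) / 2.
  rewrite rmorph_sum -big_split mulr_suml; apply: eq_bigr => u _ /=.
  rewrite rmorph_sum -big_split mulr_suml; apply: eq_bigr => v _ /=.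
  rewrite !rmorphM /= !conjCK ReE.
  by rewrite -mulrDl -mulrDr !mulrA mulrAC.
by rewrite divr_ge0 ?ler0n // addr_ge0 ?conjC_ge0 ?Kpos.
Qed.

(** Each diagonal entry of [P *m A *m P^t*] is the value of the form of [A] at
    the adjoint of a row of [P]. *)
Lemma psdmx_trace_ge0 n p (P : 'M[C]_(p, n)) (A : 'M[C]_n) :
  psdmx A -> 0 <= \tr (P *m A *m P^t*).
Proof.
move=> [_ Apos]; apply: sumr_ge0 => i _; have := Apos (col i (P^t*)).
suff -> : ((col i (P^t*))^t* *m A *m col i (P^t*)) 0 0 =
    (P *m A *m P^t*) i i by [].
have -> : (col i (P^t*))^t* = row i P.
  by apply/rowP => j; rewrite !mxE conjCK.
by rewrite -row_mul !mxE; apply: eq_bigr => j _; rewrite !mxE.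
Qed.

End PositiveKernels.

(** * Unitary representations and the regular character *)

Section UnitaryRepresentations.

Variables (R : realType) (gT : finGroupType).
Local Notation C := R[i].
Local Notation repr := (mx_representation C [set: gT]).

Lemma repr_setTM n (rho : repr n) x y : rho (x * y)%g = rho x *m rho y.
Proof. by rewrite repr_mxM ?inE. Qed.

Lemma unitary_reprV n (rho : repr n) x :
  unitary_repr rho -> rho x^-1%g = (rho x)^t*.
Proof. by move=> Urho; rewrite repr_mxV ?inE// invmx_unitary. Qed.

(** Weyl's unitary trick.  The average [H] of the [rho x *m (rho x)^t*] is fixed
    by [M |-> rho y *m M *m (rho y)^t*] and positive definite, so it is
    [T *m T^t*] with [T] invertible by the spectral theorem, and conjugating by
    [T] turns the invariance of [H] into that of the identity. *)
Lemma unitarizable n (rho : repr n) :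
  exists2 T : 'M[C]_n, T \in unitmx &
    forall x, invmx T *m rho x *m T \is unitarymx.
Proof.
pose H : 'M[C]_n := \sum_x rho x *m (rho x)^t*.
have rhoH y : rho y *m H *m (rho y)^t* = H.
  rewrite /H mulmx_sumr mulmx_suml (reindex_inj (mulgI y^-1%g)) /=.
  apply: eq_bigr => x _; rewrite -mulmxA -[_ *m _^t* *m _]mulmxA -adjmxM.
  by rewrite mulmxA -!repr_setTM mulKVg.
have Hherm : H \is hermsymmx.
  apply/is_hermitianmxP; rewrite scale1r /H !raddf_sum /=.
  by apply: eq_bigr => x _; rewrite adjmxM trmxCK.
have /orthomx_spectralP := hermitian_normalmx Hherm.
set U := spectralmx H; set d := spectral_diag H => HE.
have Uu : U \is unitarymx by exact: spectral_unitarymx.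
(* The term of [H] at the unit of the group is the identity and contributes [1]
   to each eigenvalue; the other terms contribute nonnegative amounts. *)
have d_ge1 i : 1 <= d 0 i.
  have -> : d 0 i = (U *m H *m U^t*) i i.
    rewrite HE invmx_unitary // !mulmxA (unitarymxP _) // mul1mx -mulmxA.
    by rewrite (unitarymxP _) // mulmx1 mxE eqxx.
  rewrite mulmx_sumr mulmx_suml summxE (bigD1 1%g) //= repr_mx1.
  rewrite mul1mx trmx1 map_mx1 mulmx1 (unitarymxP _) // mxE eqxx lerDl.
  apply: sumr_ge0 => x _; rewrite mulmxA -mulmxA -adjmxM mulmx_adj_diag.
  by apply: sumr_ge0 => j _; rewrite exprn_ge0.
have d_gt0 i : 0 < d 0 i by exact: lt_le_trans (d_ge1 i).
clearbody U d H.
pose s : 'rV[C]_n := map_mx sqrtC d.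
pose T := U^t* *m diag_mx s.
have TT : T *m T^t* = H.
  rewrite adjmxM trmxCK [RHS]HE (invmx_unitary Uu) !mulmxA; congr (_ *m _).
  rewrite -mulmxA; congr (_ *m _).
  rewrite tr_diag_mx map_diag_mx mulmx_diag; congr diag_mx.
  apply/rowP => i; rewrite !mxE -normCK ger0_norm ?sqrtCK //.
  by rewrite sqrtC_ge0 ltW.
have Tu : T \in unitmx.
  rewrite unitmx_mul -invmx_unitary // unitmx_inv unitarymx_unit //=.
  rewrite unitmxE det_diag unitfE; apply/prodf_neq0 => i _.
  by rewrite mxE sqrtC_eq0 gt_eqF.
clearbody T; exists T; first exact: Tu.
move=> x; apply/unitarymxP.
have ITT : invmx T *m H *m (invmx T)^t* = 1%:M.
  by rewrite -TT mulmxA mulVmx // mul1mx -adjmxM mulVmx // trmx1 map_mx1.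
rewrite -[RHS]ITT -(rhoH x) -TT.
rewrite (adjmxM _ T) (adjmxM (invmx T) (rho x)).
by rewrite !mulmxA.
Qed.

Lemma irreducible_cent_scalar n (rho : repr n) (f : 'M[C]_n) :
  mx_irreducible rho -> (forall x, rho x *m f = f *m rho x) ->
  exists c, f = c%:M.
Proof.
move=> irr cf; apply/is_scalar_mxP.
apply: (mx_abs_irr_cent_scalar (group_closure_closed_field irr)).
by apply/centgmxP => x _; rewrite cf.
Qed.

(** An intertwiner [B] between irreducible unitary representations is a multiple
    of a unitary matrix: [B *m B^t*] commutes with [rho], so it is a scalar [c]
    by Schur's lemma, and [c > 0]; hence [B / sqrt c] is unitary. *)
Lemma rsim_unitary_equiv m n (rho : repr m) (sigma : repr n) :
  unitary_repr rho -> unitary_repr sigma -> mx_irreducible rho ->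
  mx_rsim rho sigma -> unitary_equiv rho sigma.
Proof.
move=> Urho Usigma irr [B emn]; case: _ / emn in sigma Usigma B * => Bfree BE.
split=> //; have {}BE x : rho x *m B = B *m sigma x by rewrite BE ?inE.
have [x|c Bc] := irreducible_cent_scalar (f := B *m B^t*) irr.
  rewrite mulmxA BE -!mulmxA; congr (_ *m _).
  have := congr1 (fun M => M^t*) (BE x^-1%g).
  by rewrite !adjmxM !unitary_reprV // !trmxCK.
have Bu : B \in unitmx by rewrite -row_free_unit.
have m_gt0 : (0 < m)%N by case/mx_irrP: irr.
have c_ge0 : 0 <= c.
  have := mulmx_adj_diag B (Ordinal m_gt0); rewrite Bc mxE eqxx mulr1n => ->.
  by apply: sumr_ge0 => j _; rewrite exprn_ge0.
have c_neq0 : c != 0.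
  have : B *m B^t* \in unitmx by rewrite unitmx_mul map_unitmx unitmx_tr Bu.
  by rewrite Bc unitmxE det_scalar unitfE expf_eq0 m_gt0 andTb.
have k_real : ((sqrtC c)^-1)^* = (sqrtC c)^-1.
  by apply/CrealP; rewrite realV ger0_real // sqrtC_ge0.
exists ((sqrtC c)^-1 *: B) => [|x]; last by rewrite -scalemxAr BE scalemxAl.
apply/unitarymxP; rewrite linearZ /= map_mxZ /= k_real.
rewrite -scalemxAl -scalemxAr Bc scalerA -invfM -expr2 sqrtCK.
by rewrite scale_scalar_mx mulVf.
Qed.

Variable D : unitary_dual R gT.

Lemma dual_rsim_eq (p q : D) : mx_rsim (irrep p) (irrep q) -> p = q.
Proof.
move=> pq; apply: irrep_inequiv; apply: rsim_unitary_equiv pq.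
- exact: irrep_unitary.
- exact: irrep_unitary.
- exact: irrep_irreducible.
Qed.

Lemma dual_rsim_complete n (rho : repr n) :
  mx_irreducible rho -> exists p : D, mx_rsim rho (irrep p).
Proof.
move=> irr; have [T Tu TU] := unitarizable rho.
have Tiu : invmx T \in unitmx by rewrite unitmx_inv.
pose sigma := rconj_repr rho Tiu.
have sigmaE x : sigma x = invmx T *m rho x *m T.
  by rewrite /= /rconj_mx invmxK.
have irr' : mx_irreducible sigma by apply/conj_mx_irr.
have U' : unitary_repr sigma by move=> x; rewrite sigmaE.
have [p [e [U Uu UE]]] := irrep_complete D irr' U'.
exists p; apply: (@mx_rsim_trans _ _ _ _ _ _ _ sigma).
  exists T => //; first by rewrite row_free_unit.
  by move=> x _; rewrite sigmaE !mulmxA mulmxV // mul1mx.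
by exists U => //; rewrite /row_free mxrank_unitary.
Qed.

Lemma pchar'_complex (G : {group gT}) : ([pchar C]^'.-group G)%g.
Proof. by rewrite /pgroup pcharf'_nat pnatr_eq0 -lt0n cardG_gt0. Qed.

(** Translation by [x != 1] permutes the group without fixed points. *)
Lemma trace_regular x :
  \tr (regular_repr C [set: gT] x) = #|gT|%:R * (x == 1%g)%:R.
Proof.
have [->|x1] := eqVneq x 1%g.
  by rewrite repr_mx1 mxtrace1 /gcard cardsT mulr1.
rewrite mulr0 /mxtrace big1 // => i _; rewrite !mxE /=.
case: eqP => // iE; case/eqP: x1; apply: (mulgI (enum_val i)).
by rewrite mulg1 {2}iE gring_indexK ?inE.
Qed.

(** The regular representation contains each irreducible representation with
    multiplicity its degree.  The classification of irreducible representations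
    as Wedderburn components of the regular one is transported to [D]: the map
    [phi] sending [p] to its component is injective and onto. *)
Lemma dual_trace_sum x :
  \sum_(p : D) (deg p)%:R * \tr (irrep p x) = #|gT|%:R * (x == 1%g)%:R.
Proof.
pose sG := DecSocleType (regular_repr C [set: gT]).
have C'G := pchar'_complex [set: gT]%G.
pose phi (p : D) := irr_comp sG (irrep p).
have phiP p : mx_rsim (irrep p) (irr_repr (phi p)).
  exact: (rsim_irr_comp_pchar sG C'G (irrep_irreducible p)).
have phi_inj : injective phi.
  move=> p q pq; apply: dual_rsim_eq; apply: mx_rsim_trans (phiP p) _.
  by rewrite pq; apply: mx_rsim_sym.
have phi_onto i : exists p, phi p == i.
  have [p pi] := dual_rsim_complete (socle_irr i); exists p; apply/eqP.
  by rewrite /phi -(irr_comp_rsim_pchar sG C'G pi) irr_reprK_pchar.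
have phi_bij : bijective phi.
  exists (fun i => xchoose (phi_onto i)) => [p|i].
    by apply: phi_inj; apply/eqP; exact: xchooseP (phi_onto (phi p)).
  by apply/eqP; exact: xchooseP (phi_onto i).
rewrite -trace_regular (mxtrace_regular_pchar sG) ?inE //; last first.
  exact: group_closure_closed_field.
rewrite (reindex phi) /=; last exact: onW_bij.
apply: eq_bigr => p _; rewrite (mxtrace_rsim (phiP p)) ?inE // mulr_natl.
by congr (_ *+ _); have [B] := phiP p.
Qed.

(** A nonzero fixed vector spans an invariant line, which fills the whole space
    of an irreducible representation. *)
Lemma rsim_trivial m n (sigma : repr m) (rho : repr n) (v : 'rV_n) :
  m = 1%N -> (forall x, sigma x = 1%:M) -> mx_irreducible rho ->
  v != 0 -> (forall x, v *m rho x = v) -> mx_rsim sigma rho.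
Proof.
move=> m1; rewrite {}m1 in sigma * => triv /mx_irrP[_ irr] v0 vE.
have rv : \rank v = 1%N by rewrite rank_rV v0.
have /eqP : row_full <<v>>%MS.
  apply: irr; last by rewrite -mxrank_eq0 genmxE rv.
  by rewrite (eqmx_module _ (genmxE v)); apply/mxmoduleP=> x _; rewrite vE.
rewrite genmxE rv => n1; exists v => // [|x _]; first by rewrite /row_free rv.
by rewrite triv mul1mx vE.
Qed.

(** Every row of [\sum_x irrep p x] is a fixed vector, because right
    multiplication by [irrep p x] permutes the summands. *)
Lemma sum_irrep_nontrivial (one p : D) :
  deg one = 1%N -> (forall x, irrep one x = 1%:M) -> p != one ->
  \sum_x irrep p x = 0.
Proof.
move=> deg1 triv p1; apply/row_matrixP => i; rewrite row0.
set v := row i _; apply/eqP; apply: contraR p1 => v0.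
apply/eqP/esym/dual_rsim_eq.
apply: rsim_trivial deg1 triv (irrep_irreducible p) v0 _ => x.
rewrite /v -row_mul; congr row.
rewrite mulmx_suml [RHS](reindex_inj (mulIg x)) /=.
by apply: eq_bigr => y _; rewrite repr_setTM.
Qed.

End UnitaryRepresentations.

(** * Positive definite functions and the Fourier transform *)

Section PositiveDefiniteFunctions.

Variables (R : realType) (gT : finGroupType).
Local Notation C := R[i].

Definition posdef_fun (f : gT -> C) : Prop :=
  psd_kernel (fun x y => f (y^-1 * x)%g).

Definition feasible_fun (X : {set gT}) (f : gT -> C) : Prop :=
  [/\ posdef_fun f, forall g, f g \is Num.real, f 1%g = 1 &
      forall x, x \in X -> f x = 0].

Lemma cardG_neq0 : #|gT|%:R != 0 :> C.
Proof. by rewrite pnatr_eq0 -lt0n; apply/card_gt0P; exists 1%g. Qed.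

Lemma mxtrace_entry (V : finType) (A : 'M[C]_#|V|) :
  \tr A = \sum_u entry A u u.
Proof. exact: reindex (onW_bij _ (enum_rank_bij V)). Qed.

Definition kernel_average (K : gT -> gT -> C) (g : gT) : C :=
  \sum_z K (z * g)%g z.

(** The kernel attached to the average of [K] is the sum over [w] of the
    translates [K (w * x) (w * y)], each of them positive semidefinite. *)
Lemma posdef_kernel_average (K : gT -> gT -> C) :
  psd_kernel K -> posdef_fun (kernel_average K).
Proof.
move=> Kpos c.
suff -> : \sum_x \sum_y (c x)^* * kernel_average K (y^-1 * x)%g * c y =
    \sum_w \sum_u \sum_v (c (w^-1 * u)%g)^* * K u v * c (w^-1 * v)%g.
  by apply: sumr_ge0 => w _; apply: Kpos.
have -> : \sum_w \sum_u \sum_v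
      (c (w^-1 * u)%g)^* * K u v * c (w^-1 * v)%g =
    \sum_w \sum_x \sum_y (c x)^* * K (w * x)%g (w * y)%g * c y.
  apply: eq_bigr => w _; rewrite (reindex_inj (mulgI w)) /=.
  apply: eq_bigr => x _; rewrite (reindex_inj (mulgI w)) /=.
  by apply: eq_bigr => y _; rewrite !mulKg.
rewrite [RHS]exchange_big; apply: eq_bigr => x _ /=.
rewrite [RHS]exchange_big; apply: eq_bigr => y _ /=.
rewrite /kernel_average (reindex_inj (mulIg y)) mulr_sumr mulr_suml /=.
by apply: eq_bigr => w _; rewrite -mulgA mulKVg.
Qed.

Lemma sum_left_invariant (f : gT -> C) :
  \sum_x \sum_y f (y^-1 * x)%g = #|gT|%:R * \sum_g f g.
Proof.
rewrite exchange_big /= (eq_bigr (fun=> \sum_g f g)) => [|y _].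
  by rewrite sumr_const mulr_natl.
by rewrite [RHS](reindex_inj (mulgI y^-1%g)).
Qed.

(** From matrices to functions by averaging over left translations; back by
    taking the normalised translation-invariant kernel of [f]. *)
Lemma theta_valuesP (X : {set gT}) (t : R) :
  theta_values R (Cay X) t <->
  exists2 f, feasible_fun X f & (t%:C)%C = \sum_g f g.
Proof.
split=> [[A [Apsd Areal trA Aedge] tE]|[f [fpd freal f1 fX] tE]].
  exists (kernel_average (entry A)); last first.
    rewrite tE /kernel_average [RHS]exchange_big [LHS]exchange_big /=.
    by apply: eq_bigr => z _; rewrite (reindex_inj (mulgI z)).
  split=> [|g||x xX].
  - by apply: posdef_kernel_average; apply/psdmx_entry.
  - by apply: rpred_sum => z _; apply: (mxOverP Areal).
  - by rewrite -trA mxtrace_entry; apply: eq_bigr => z _; rewrite mulg1.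
  - by apply: big1 => z _; apply: Aedge; rewrite /Cay mulKg.
pose N : C := #|gT|%:R.
pose A : 'M[C]_#|gT| := \matrix_(i, j)
  (N^-1 * f ((enum_val j)^-1 * enum_val i)%g).
have AE u v : entry A u v = N^-1 * f (v^-1 * u)%g.
  by rewrite /entry mxE !enum_rankK.
exists A; last first.
  rewrite tE; symmetry.
  under eq_bigr => u _ do under eq_bigr => v _ do rewrite AE.
  under eq_bigr do rewrite -mulr_sumr.
  by rewrite -mulr_sumr sum_left_invariant mulKf ?cardG_neq0.
split.
- apply/psdmx_entry => c.
  under eq_bigr => u _ do under eq_bigr => v _ do rewrite AE mulrCA -mulrA.
  under eq_bigr do rewrite -mulr_sumr.
  by rewrite -mulr_sumr mulr_ge0 ?invr_ge0 ?ler0n //; apply: fpd.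
- apply/mxOverP => i j; rewrite mxE rpredM //.
  by rewrite realV realn.
- rewrite mxtrace_entry; under eq_bigr do rewrite AE mulVg f1 mulr1.
  by rewrite sumr_const -(mulr_natr N^-1) mulVf ?cardG_neq0.
- by move=> u v /fX E; rewrite AE E mulr0.
Qed.

Variable D : unitary_dual R gT.

Lemma mxinner_irrepV (p : D) (A : 'M[C]_(deg p)) x y :
  mxinner A (irrep p (y^-1 * x)%g) = \tr (irrep p y *m A *m (irrep p x)^t*).
Proof.
rewrite /mxinner -!(unitary_reprV _ (irrep_unitary p)) invMg invgK.
by rewrite repr_setTM -[X in \tr X = _]mulmxA [LHS]mxtrace_mulC.
Qed.

Definition inverse_fourier (A : forall p : D, 'M[C]_(deg p)) (x : gT) : C :=
  #|gT|%:R^-1 * \sum_p (deg p)%:R * mxinner (A p) (irrep p x).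

Definition fourier (f : gT -> C) (p : D) : 'M[C]_(deg p) :=
  \sum_x f x *: irrep p x.

(** By unitarity the form of [inverse_fourier A] at [c] is, up to the factor
    [#|gT|^-1], the sum of the numbers [d_p * tr (P_p A_p P_p')], where [P_p] is
    [\sum_y c y *: irrep p y] and [P_p'] its adjoint. *)
Lemma posdef_inverse_fourier (A : forall p : D, 'M[C]_(deg p)) :
  (forall p, psdmx (A p)) -> posdef_fun (inverse_fourier A).
Proof.
move=> Apsd c; pose P (p : D) : 'M[C]_(deg p) := \sum_y c y *: irrep p y.
suff -> : \sum_x \sum_y (c x)^* * inverse_fourier A (y^-1 * x)%g * c y =
    #|gT|%:R^-1 * \sum_p (deg p)%:R * \tr (P p *m A p *m (P p)^t*).
  rewrite mulr_ge0 ?invr_ge0 ?ler0n // sumr_ge0 // => p _.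
  by rewrite mulr_ge0 ?ler0n //; apply: psdmx_trace_ge0.
have PE p : \tr (P p *m A p *m (P p)^t*) =
    \sum_x \sum_y (c x)^* * mxinner (A p) (irrep p (y^-1 * x)%g) * c y.
  have -> : (P p)^t* = \sum_x (c x)^* *: (irrep p x)^t*.
    rewrite /P !raddf_sum; apply: eq_bigr => x _.
    by rewrite /= linearZ /= map_mxZ.
  rewrite mulmx_sumr raddf_sum; apply: eq_bigr => x _ /=.
  rewrite !mulmx_suml raddf_sum; apply: eq_bigr => y _ /=.
  rewrite mxinner_irrepV -scalemxAr -!scalemxAl !mxtraceZ.
  by rewrite -mulrA (mulrC (c y)).
under [in RHS]eq_bigr do rewrite PE.
rewrite mulr_sumr; under [RHS]eq_bigr => p _ do
  rewrite mulr_sumr mulr_sumr.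
rewrite [RHS]exchange_big; apply: eq_bigr => x _ /=.
under [RHS]eq_bigr => p _ do rewrite mulr_sumr mulr_sumr.
rewrite [RHS]exchange_big; apply: eq_bigr => y _ /=.
rewrite /inverse_fourier mulr_sumr mulr_sumr mulr_suml.
apply: eq_bigr => p _; rewrite -!mulrA mulrCA.
by congr (_ * _); rewrite mulrCA.
Qed.

(** Only the trivial representation survives the summation over the group. *)
Lemma sum_inverse_fourier (one : D) (A : forall p : D, 'M[C]_(deg p)) :
  deg one = 1%N -> (forall x, irrep one x = 1%:M) ->
  \sum_x inverse_fourier A x = \tr (A one).
Proof.
move=> deg1 triv; rewrite -mulr_sumr exchange_big /=.
have sumE p : \sum_x (deg p)%:R * mxinner (A p) (irrep p x) =
    (deg p)%:R * mxinner (A p) (\sum_x irrep p x).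
  rewrite -mulr_sumr /mxinner !raddf_sum mulmx_suml raddf_sum.
  by [].
under eq_bigr do rewrite sumE.
rewrite (bigD1 one) //= [X in _ + X]big1 ?addr0 => [|p p1]; last first.
  rewrite (sum_irrep_nontrivial deg1 triv p1).
  by rewrite /mxinner trmx0 map_mx0 mul0mx mxtrace0 mulr0.
have -> : \sum_x irrep one x = (#|gT|%:R)%:M.
  rewrite (eq_bigr _ (fun x _ => triv x)) sumr_const -scaler_nat.
  by rewrite scalemx1.
rewrite /mxinner tr_scalar_mx map_scalar_mx mul_scalar_mx mxtraceZ rmorph_nat.
by rewrite [X in X%:R * _]deg1 mul1r mulKf ?cardG_neq0.
Qed.

(** Writing each group element as [y^-1 * x] in all [#|gT|] ways turns the form
    of [fourier f p] at [v] into [#|gT|^-1] times the sum over the coordinates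
    [k] of the form of [f] at the conjugate of
    [x |-> (irrep p x *m v) k]. *)
Lemma psdmx_fourier (f : gT -> C) (p : D) :
  posdef_fun f -> psdmx (fourier f p).
Proof.
move=> fpd; apply: psdmx_quad => v.
pose w x : 'cV[C]_(deg p) := irrep p x *m v.
suff -> : (v^t* *m fourier f p *m v) 0 0 =
    #|gT|%:R^-1 * \sum_k \sum_x \sum_y
      ((w x k 0)^*)^* * f (y^-1 * x)%g * (w y k 0)^*.
  by rewrite mulr_ge0 ?invr_ge0 ?ler0n // sumr_ge0 // => k _; apply: fpd.
apply: (mulfI cardG_neq0); rewrite mulVKf ?cardG_neq0 //.
pose q x := (v^t* *m irrep p x *m v) 0 0.
have -> : (v^t* *m fourier f p *m v) 0 0 = \sum_x f x * q x.
  rewrite mulmx_sumr mulmx_suml summxE; apply: eq_bigr => x _.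
  by rewrite -scalemxAr -scalemxAl mxE.
rewrite -sum_left_invariant [RHS]exchange_big; apply: eq_bigr => x _ /=.
rewrite [RHS]exchange_big; apply: eq_bigr => y _ /=.
have -> : q (y^-1 * x)%g = ((w y)^t* *m w x) 0 0.
  rewrite /w adjmxM -(unitary_reprV _ (irrep_unitary p)) /q repr_setTM.
  by rewrite !mulmxA.
rewrite mxE mulr_sumr; apply: eq_bigr => k _.
clearbody w; rewrite !mxE conjCK.
by rewrite (mulrC _ (w x k 0)) mulrA (mulrC (f _)).
Qed.

(** The pairing unfolds to [\sum_y f y * \sum_p d_p tr p(x^-1 * y)], and the
    decomposition of the regular character selects [y = x]. *)
Lemma fourier_inversion (f : gT -> C) x :
  \sum_(p : D) (deg p)%:R * mxinner (fourier f p) (irrep p x) =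
  #|gT|%:R * f x.
Proof.
have innerE (p : D) : (deg p)%:R * mxinner (fourier f p) (irrep p x) =
    \sum_y f y * ((deg p)%:R * \tr (irrep p (x^-1 * y)%g)).
  rewrite /mxinner mulmx_sumr raddf_sum mulr_sumr; apply: eq_bigr => y _ /=.
  rewrite -scalemxAr mxtraceZ -(unitary_reprV _ (irrep_unitary p)).
  by rewrite -repr_setTM mulrCA.
under eq_bigr do rewrite innerE.
rewrite exchange_big /=; under eq_bigr do rewrite -mulr_sumr dual_trace_sum.
rewrite (bigD1 x) //= mulVg eqxx mulr1 big1 ?addr0 1?mulrC // => y yx.
by rewrite -eq_mulVg1 eq_sym (negPf yx) !mulr0.
Qed.

Lemma mxinner1 n (A : 'M[C]_n) : mxinner A 1%:M = \tr A.
Proof. by rewrite /mxinner trmx1 map_mx1 mul1mx. Qed.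

Lemma castmx_trace n (n1 : n = 1%N) (A : 'M[C]_n) :
  castmx (n1, n1) A 0 0 = \tr A.
Proof. by move: A (n1); rewrite n1 => A e; rewrite castmx_id trace_mx11. Qed.

(** The inverse transform of a feasible family may take complex values away
    from the unit.  Its real part is still positive definite and keeps the sum,
    which is the real number [t].  In the other direction the inversion formula
    at [1] and on [X] gives the linear constraints. *)
Lemma dual_valuesP (one : D) (deg1 : deg one = 1%N) (X : {set gT}) (t : R) :
  (forall x, irrep one x = 1%:M) ->
  dual_values deg1 X t <->
  exists2 f, feasible_fun X f & (t%:C)%C = \sum_g f g.
Proof.
move=> triv; split=> [[A [Apsd trA AX] tE]|[f [fpd freal f1 fX] tE]].
  pose h := inverse_fourier A.
  exists (fun x => 'Re (h x)); last first.
    rewrite -raddf_sum (sum_inverse_fourier A deg1 triv) -castmx_trace -tE.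
    by symmetry; apply/Creal_ReP; apply/complex_realP; exists t.
  split=> [|g||x xX].
  - by apply: psd_kernel_Re; apply: posdef_inverse_fourier.
  - exact: Creal_Re.
  - rewrite /h /inverse_fourier.
    under eq_bigr do rewrite repr_mx1 mxinner1.
    rewrite trA mulVf ?cardG_neq0 //; apply/Creal_ReP; exact: real1.
  - by rewrite /h /inverse_fourier AX // mulr0 raddf0.
exists (fourier f); last first.
  rewrite tE castmx_trace /fourier raddf_sum; apply: eq_bigr => x _ /=.
  by rewrite triv mxtraceZ mxtrace1 deg1 mulr1.
split=> [p||x xX].
- exact: psdmx_fourier.
- have := fourier_inversion f 1%g; rewrite f1 mulr1 => <-.
  by apply: eq_bigr => p _; rewrite repr_mx1 mxinner1.
- by rewrite fourier_inversion fX ?mulr0.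
Qed.

End PositiveDefiniteFunctions.

(** * Attainment of the theta number *)

Local Open Scope classical_set_scope.

Section Attainment.

Variable R : realType.
Local Notation C := R[i].

(** The form is nonnegative at the sum and at the difference of two basis
    vectors, so [2 `|A i j| <= A i i + A j j], and every diagonal entry is at
    most the trace since all are nonnegative. *)
Lemma psdmx_norm_entry_le_trace n (A : 'M[C]_n) i j :
  psdmx A -> A \is a realmx -> `|A i j| <= \tr A.
Proof.
move=> [Aherm Apos] Areal.
have quad_pair (s : C) : s \is Num.real -> s ^+ 2 = 1 ->
    0 <= A i i + A j j + s * (A i j + A j i).
  move=> sreal s2; have := Apos (delta_mx i 0 + s *: delta_mx j 0).
  have -> : (delta_mx i 0 + s *: delta_mx j 0)^t* =
      delta_mx 0 i + s *: delta_mx 0 j :> 'rV[C]_n.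
    rewrite linearD linearZ /= !trmx_delta map_mxD map_mxZ !map_delta_mx.
    by rewrite /= (CrealP sreal).
  rewrite mulmxDl -scalemxAl -!rowE mulmxDr -scalemxAr -!colE !mxE.
  rewrite mulrDr mulrA -expr2 s2 mul1r.
  congr (0 <= _); rewrite mulrDr addrACA [RHS]addrACA addrC.
  by rewrite addrC [s * A j i + _]addrC.
have Asym : A j i = A i j.
  have /is_hermitianmxP AE := Aherm; rewrite {1}AE scale1r !mxE.
  by apply/CrealP; apply: (mxOverP Areal).
have diag_ge0 k : 0 <= A k k.
  have := Apos (delta_mx k 0).
  by rewrite trmx_delta map_delta_mx -rowE -colE !mxE.
have diag_le k : A k k <= \tr A.
  by rewrite /mxtrace (bigD1 k) //= lerDl sumr_ge0.
have diag2 : A i i + A j j <= \tr A *+ 2 by rewrite mulr2n lerD.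
rewrite real_ler_norml ?(mxOverP Areal) //; apply/andP; split.
  have := quad_pair 1 (rpred1 _) (expr1n _ _).
  rewrite Asym mul1r -mulr2n => h; rewrite -(ler_pMn2r (ltn0Sn 1)) mulNrn.
  by rewrite lerNl (le_trans _ diag2) // -subr_ge0 opprK.
have := quad_pair (-1) (rpredN1 _) (sqrr_sign _ 1).
rewrite Asym mulN1r -mulr2n => h; rewrite -(ler_pMn2r (ltn0Sn 1)).
by rewrite (le_trans _ diag2) // -subr_ge0.
Qed.

(** Real matrices are read off row vectors, where a product of segments is
    compact by [rV_compact].  The linear form has complex coefficients so that
    it covers the quadratic form at a complex vector, the trace and the
    entries alike. *)
Definition pairing n (k : 'I_n -> 'I_n -> C) (v : 'rV[R]_(n * n)) : C :=
  \sum_i \sum_j k i j * ((vec_mx v i j)%:C)%C.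

Lemma Re_pairing n (k : 'I_n -> 'I_n -> C) v :
  complex.Re (pairing k v) = \sum_i \sum_j complex.Re (k i j) * vec_mx v i j.
Proof.
have ReD : {morph @complex.Re R : x y / x + y} by move=> [? ?] [? ?].
rewrite (big_morph _ ReD (erefl _)); apply: eq_bigr => i _.
rewrite (big_morph _ ReD (erefl _)); apply: eq_bigr => j _.
by case: (k i j) => a b /=; rewrite mulr0 subr0.
Qed.

Lemma Im_pairing n (k : 'I_n -> 'I_n -> C) v :
  complex.Im (pairing k v) = \sum_i \sum_j complex.Im (k i j) * vec_mx v i j.
Proof.
have ImD : {morph @complex.Im R : x y / x + y} by move=> [? ?] [? ?].
rewrite (big_morph _ ImD (erefl _)); apply: eq_bigr => i _.
rewrite (big_morph _ ImD (erefl _)); apply: eq_bigr => j _.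
by case: (k i j) => a b /=; rewrite mulr0 add0r.
Qed.

Lemma continuous_real_pairing n (k : 'I_n -> 'I_n -> R) :
  continuous (fun v : 'rV[R]_(n * n) => \sum_i \sum_j k i j * vec_mx v i j).
Proof.
apply: continuous_big => [|i _]; first exact: add_continuous.
apply: continuous_big => [|j _]; first exact: add_continuous.
have -> : (fun v : 'rV[R]_(n * n) => k i j * vec_mx v i j) =
    (fun v => k i j * v 0 (mxvec_index i j)).
  by apply/funext => v; rewrite mxE.
by move=> v; apply: cvgMl_tmp; [exact: nbhs_filter|exact: coord_continuous].
Qed.

Lemma closed_real_pairing n (k : 'I_n -> 'I_n -> R) (S : set R) :
  closed S ->
  closed ((fun v : 'rV_(n * n) => \sum_i \sum_j k i j * vec_mx v i j) @^-1` S).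
Proof.
by move=> Scl; apply: preimage_closed => // v _; apply: continuous_real_pairing.
Qed.

Lemma closed_pairing_eq n (k : 'I_n -> 'I_n -> C) (c : C) :
  closed [set v | pairing k v = c].
Proof.
have -> : [set v | pairing k v = c] =
    (fun v => complex.Re (pairing k v)) @^-1` [set x | x = complex.Re c] `&`
    (fun v => complex.Im (pairing k v)) @^-1` [set x | x = complex.Im c].
  apply/seteqP; split => v /=; first by move=> ->.
  by case=> reE imE; apply/eqP; rewrite eq_complex reE imE !eqxx.
rewrite (funext (Re_pairing k)) (funext (Im_pairing k)).
by apply: closedI; apply: closed_real_pairing; apply: closed_eq.
Qed.

Lemma closed_pairing_ge0 n (k : 'I_n -> 'I_n -> C) :
  closed [set v | 0 <= pairing k v].
Proof.
have -> : [set v | 0 <= pairing k v] =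
    (fun v => complex.Re (pairing k v)) @^-1` [set x | 0 <= x] `&`
    (fun v => complex.Im (pairing k v)) @^-1` [set x | x = 0].
  apply/seteqP; split => v /=; rewrite lecE /=; first by case/andP => /eqP.
  by case=> re_ge0 im0; rewrite im0 re_ge0 eqxx.
rewrite (funext (Re_pairing k)) (funext (Im_pairing k)).
apply: closedI.
  by apply: closed_real_pairing; apply: closed_ge.
by apply: closed_real_pairing; apply: closed_eq.
Qed.

Lemma complex_vec_mx_surj n (A : 'M[C]_n) :
  A \is a realmx ->
  exists v : 'rV[R]_(n * n), A = map_mx (real_complex R) (vec_mx v).
Proof.
move=> Areal; exists (mxvec (map_mx (@complex.Re R) A)).
apply/matrixP => i j; rewrite mxvecK !mxE.
by apply/esym/RRe_real/(mxOverP Areal).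
Qed.

Variables (V : finType) (E : rel V).
Local Notation n := #|V|.

Definition theta_spectrahedron : set 'rV[R]_(n * n) :=
  [set v | theta_feasible E (map_mx (real_complex R) (vec_mx v))].

(** Feasibility expressed by closed conditions on linear forms in the entries
    only: by [psdmx_quad] the nonnegativity of the quadratic form includes
    the Hermitian symmetry. *)
Lemma theta_spectrahedronE : theta_spectrahedron =
  (\bigcap_(x in [set: 'cV[C]_n])
     [set v | 0 <= pairing (fun i j => (x i 0)^* * x j 0) v]) `&`
  [set v | pairing (fun i j => (i == j)%:R) v = 1] `&`
  (\bigcap_(p in [set p : V * V | E p.1 p.2])
     [set v | pairing (fun i j =>
        ((i == enum_rank p.1) && (j == enum_rank p.2))%:R) v = 0]).
Proof.
have pairing_quad v (x : 'cV[C]_n) :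
    (x^t* *m map_mx (real_complex R) (vec_mx v) *m x) 0 0 =
    pairing (fun i j => (x i 0)^* * x j 0) v.
  rewrite quadE; apply: eq_bigr => i _; apply: eq_bigr => j _.
  by rewrite !mxE mulrAC.
have pairing_tr v : pairing (fun i j => (i == j)%:R) v =
    \tr (map_mx (real_complex R) (vec_mx v)).
  apply: eq_bigr => i _; rewrite (bigD1 i) //= eqxx mul1r big1 ?addr0 ?mxE //.
  by move=> j ji; rewrite eq_sym (negPf ji) mul0r.
have pairing_entry v (p : V * V) :
    pairing (fun i j => ((i == enum_rank p.1) && (j == enum_rank p.2))%:R) v =
    entry (map_mx (real_complex R) (vec_mx v)) p.1 p.2.
  rewrite /pairing (bigD1 (enum_rank p.1)) //= (bigD1 (enum_rank p.2)) //=.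
  rewrite !eqxx mul1r !big1 ?addr0 => [|i pi|j pj].
  - by rewrite /entry !mxE.
  - by apply: big1 => j _; rewrite (negPf pi) mul0r.
  - by rewrite (negPf pj) mul0r.
apply/seteqP; split => v /=.
  move=> [[_ Apos] _ trA AE]; split; last first.
    by move=> p pE; rewrite /= pairing_entry; apply: AE.
  by split; [move=> x _ /=; rewrite -pairing_quad | rewrite /= pairing_tr].
move=> [[Apos trA] AE]; split.
- by apply: psdmx_quad => x; rewrite pairing_quad; apply: Apos.
- apply/mxOverP => i j; rewrite mxE; apply/complex_realP.
  by exists (vec_mx v i j).
- by rewrite -pairing_tr.
- by move=> a b ab; rewrite -(pairing_entry v (a, b)); apply: AE.
Qed.

Lemma theta_spectrahedron_compact : compact theta_spectrahedron.
Proof.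
apply: (@subclosed_compact _ _
    [set v : 'rV[R]_(n * n) | forall i, `[-1, 1]%classic (v ord0 i)]).
- rewrite theta_spectrahedronE; apply: closedI; first apply: closedI.
  + by apply: closed_bigI => x _; apply: closed_pairing_ge0.
  + exact: closed_pairing_eq.
  + by apply: closed_bigI => p _; apply: closed_pairing_eq.
- apply: (@rV_compact R _ (fun=> `[-1, 1]%classic)) => _.
  exact: segment_compact.
move=> v [Apsd Areal trA _] l /=; case/mxvec_indexP: l => i j.
have := psdmx_norm_entry_le_trace i j Apsd Areal.
rewrite trA !mxE in_itv /= -ler_norml.
have -> : `|(v 0 (mxvec_index i j))%:C%C| =
    (`|v 0 (mxvec_index i j)|)%:C%C :> C.
  by rewrite normc_def /= expr0n addr0 sqrtr_sqr.
by rewrite -[1]/((1 : R)%:C)%C lecR.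
Qed.

(** The normalised identity matrix is feasible; a loop of [E] would force a
    diagonal entry to vanish. *)
Lemma theta_spectrahedron_nonempty :
  irreflexive E -> (0 < #|V|)%N -> theta_spectrahedron !=set0.
Proof.
move=> Eirr V0; exists (mxvec (#|V|%:R^-1)%:M).
rewrite /theta_spectrahedron /= mxvecK map_scalar_mx /= fmorphV rmorph_nat.
split.
- apply: psdmx_quad => x; rewrite mul_mx_scalar -scalemxAl mxE.
  rewrite mulr_ge0 ?invr_ge0 ?ler0n // mxE sumr_ge0 // => i _.
  by rewrite !mxE mulrC -normCK exprn_ge0.
- by apply/mxOverP => i j; rewrite mxE rpredMn // realV realn.
- by rewrite mxtrace_scalar -(mulr_natr _^-1) mulVf // pnatr_eq0 -lt0n.
move=> u v uv; rewrite /entry mxE; case: eqP => [/enum_rank_inj uv'|//].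
by rewrite uv' Eirr in uv.
Qed.

Lemma theta_values_maximum :
  irreflexive E -> (0 < #|V|)%N ->
  exists m, is_maximum (theta_values R E) m.
Proof.
move=> Eirr V0.
(* The coefficient [1] gives [obj] the shape of a real pairing. *)
pose obj (v : 'rV[R]_(n * n)) := \sum_i \sum_j 1 * vec_mx v i j.
have objE v : ((obj v)%:C)%C =
    \sum_u \sum_w entry (map_mx (real_complex R) (vec_mx v)) u w.
  rewrite rmorph_sum (reindex _ (onW_bij _ (enum_rank_bij V))).
  apply: eq_bigr => u _ /=.
  rewrite rmorph_sum (reindex _ (onW_bij _ (enum_rank_bij V))).
  by apply: eq_bigr => w _ /=; rewrite mul1r /entry [RHS]mxE.
have [|v vP vmax] := compact_EVT_max (theta_spectrahedron_nonempty Eirr V0)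
    theta_spectrahedron_compact (f := obj).
  by apply: continuous_subspaceT; apply: continuous_real_pairing.
exists (obj v); split.
  by exists (map_mx (real_complex R) (vec_mx v)) => //; exact: set_mem vP.
move=> t [A Afeas tE]; have [_ Areal _ _] := Afeas.
have [w AE] := complex_vec_mx_surj Areal.
have -> : t = obj w by apply: complexI; rewrite objE -AE.
by apply/vmax/mem_set; rewrite /theta_spectrahedron /= -AE.
Qed.

End Attainment.

Lemma sup_maximum (R : realType) (S : set R) (m : R) :
  is_maximum S m -> sup S = m.
Proof.
move=> [Sm ub]; apply/eqP; rewrite eq_le ge_sup //=; last by exists m.
by apply: ub_le_sup => //; exists m.
Qed.

(** * The theta number of a Cayley graph *)

Theorem theorem4 (R : realType) (gT : finGroupType) (X : {set gT})
    (D : unitary_dual R gT) (one : D) (deg1 : deg one = 1%N) :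
  connection_set X ->
  (forall x : gT, irrep one x = 1%:M) ->
  is_maximum (theta_values R (Cay X)) (lovasz_theta R (Cay X)) /\
  is_maximum (dual_values deg1 X) (lovasz_theta R (Cay X)).
Proof.
move=> Xconn triv.
have gT_gt0 : (0 < #|gT|)%N by apply/card_gt0P; exists 1%g.
have [m m_max] := theta_values_maximum R (Cay_irreflexive Xconn) gT_gt0.
have theta_max : is_maximum (theta_values R (Cay X)) (lovasz_theta R (Cay X)).
  by rewrite /lovasz_theta (sup_maximum m_max).
have same_values t : dual_values deg1 X t <-> theta_values R (Cay X) t.
  exact: iff_trans (dual_valuesP deg1 X t triv) (iff_sym (theta_valuesP X t)).
split=> //; split; first by apply/same_values; exact: theta_max.1.
by move=> t /same_values; apply: theta_max.2.
Qed.
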